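(* Let $W\in\mathbb{R}^{m\times n}$ be the weight matrix of a layer, $A\in\mathbb{R}^{n\times k}$ the data (activations) flowing into that layer, $Y\in\mathbb{R}^{m\times k}$ a target, $\mathcal{L}(W)=\frac{1}{2k}\|WA-Y\|_F^2$, and $G=\nabla\mathcal{L}(W)=\frac1k(WA-Y)A^T$ the raw (unprojected) gradient. Let $M\in\mathbb{R}^{m\times n}$ be the momentum buffer, updated by $M\leftarrow\beta M+(1-\beta)G$, with singular value decomposition $M=U_M\Sigma_MV_M^T$ and singular values $\sigma_{M,i}$. For $p\in[1,\infty]$ and a step size $\eta$, consider the Schatten-$(p+1)$ update $\delta W=-\eta\,U_M\Sigma_M^{1/p}V_M^T$, for which $$\mathcal{L}(W+\delta W)-\mathcal{L}(W)=-\eta\,\langle G,U_M\Sigma_M^{1/p}V_M^T\rangle_F+\frac{\eta^2}{2k}\,\|U_M\Sigma_M^{1/p}V_M^TA\|_F^2 .$$ Then the value of $p$ that maximizes the loss decrease $\mathcal{L}(W)-\mathcal{L}(W+\delta W)$ of this update under optimal step size is $$p^*=\operatorname{argmax}_{p\in[1,\infty]}\ \frac{\left(\sum_i C_{i,i}\,\sigma_{M,i}^{1/p}\right)^2}{\sum_i\sigma_{M,i}^{2/p}\,B_{i,i}},$$ where $C_{i,i}=(U_M^TGV_M)_{i,i}$ and $B_{i,i}=\|A^TV_Me_i\|^2$.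
   Context: The singular value decomposition is the thin one: $\Sigma_M=\operatorname{diag}(\sigma_{M,i})$ is square of size $\min(m,n)$, and $U_M$, $V_M$ have orthonormal columns. $\Sigma_M^{1/p}=\operatorname{diag}(\sigma_{M,i}^{1/p})$; for $p=\infty$ the exponents $1/p$ and $2/p$ are $0$ and the update direction is $U_MV_M^T$. $e_i$ is the $i$-th standard basis vector, $\|\cdot\|$ the Euclidean norm, $\|\cdot\|_F$ the Frobenius norm and $\langle\cdot,\cdot\rangle_F$ the Frobenius inner product. ''Optimal step size'' means that, for each candidate $p$, $\eta$ is chosen to maximize the loss decrease, which is a concave quadratic in $\eta$: with $N(p)=\sum_i\sigma_{M,i}^{1/p}C_{i,i}$ and $D(p)=\sum_i\sigma_{M,i}^{2/p}B_{i,i}$ it is $\eta^\star(p)=kN(p)/D(p)$ when $N(p)>0$, and otherwise the maximum is taken to be at $\eta=0$.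
   Formalization: If the step size is set to 0 when N(p) ≤ 0, the claim is false as the criterion squares N; it is then proved only if N ≥ 0 on [1,∞], or for a maximizer p* of the criterion with N(p* ) ≥ 0. With the step size optimal over all reals, it is proved with no such condition. *)

(* Defs.v *)
From mathcomp Require Import all_boot all_order all_algebra.
From mathcomp Require Import all_classical all_reals all_analysis.

Set Implicit Arguments.
Unset Strict Implicit.
Unset Printing Implicit Defensive.

Import Order.TTheory GRing.Theory Num.Theory.
Import numFieldNormedType.Exports.

Local Open Scope classical_set_scope.
Local Open Scope ring_scope.

Definition argmax {R : realType} {T : Type} (S : set T) (f : T -> R) : set T :=
  [set x | S x /\ forall y, S y -> f y <= f x].

Definition frob {R : realType} {m n : nat} (X Z : 'M[R]_(m, n)) : R :=
  \sum_(i < m) \sum_(j < n) X i j * Z i j.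

(* Frobenius norm; on column vectors this is the Euclidean norm.  The norm
   [`|X|] that the library puts on matrices is the max norm. *)
Definition fnorm {R : realType} {m n : nat} (X : 'M[R]_(m, n)) : R :=
  Num.sqrt (frob X X).

(* The topology of 'M[R]_(m, n) does not depend on the norm, so the library's
   differential is the usual one; the gradient represents it for [frob]. *)
Definition is_gradient {R : realType} {m n : nat}
    (f : 'M[R]_(m, n) -> R) (W G : 'M[R]_(m, n)) : Prop :=
  differentiable f W /\ forall H : 'M[R]_(m, n), 'd f W H = frob G H.

Definition loss {R : realType} {m n k : nat}
    (A : 'M[R]_(n, k)) (Y : 'M[R]_(m, k)) (W : 'M[R]_(m, n)) : R :=
  (2 * k%:R)^-1 * fnorm (W *m A - Y) ^+ 2.

Definition lossgrad {R : realType} {m n k : nat}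
    (A : 'M[R]_(n, k)) (Y : 'M[R]_(m, k)) (W : 'M[R]_(m, n)) : 'M[R]_(m, n) :=
  k%:R^-1 *: ((W *m A - Y) *m A^T).

(* No ordering of the singular values is imposed. *)
Definition is_thin_svd {R : realType} {m n : nat} (M : 'M[R]_(m, n))
    (U : 'M[R]_(m, minn m n)) (sigma : 'rV[R]_(minn m n))
    (V : 'M[R]_(n, minn m n)) : Prop :=
  [/\ U^T *m U = 1%:M, V^T *m V = 1%:M, forall i, 0 <= sigma 0 i
    & M = U *m diag_mx sigma *m V^T].

Definition exponents {R : realType} : set (\bar R) := [set p | (1 <= p)%E].

(* 1/p, with 1/+oo = 0. *)
Definition recip {R : realType} (p : \bar R) : R := fine (p^-1)%E.

(* Since [0 `^ 0 = 1], this is U V^T for p = +oo, even if M is singular. *)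
Definition direction {R : realType} {m n : nat} (U : 'M[R]_(m, minn m n))
    (sigma : 'rV[R]_(minn m n)) (V : 'M[R]_(n, minn m n)) (p : \bar R) :
    'M[R]_(m, n) :=
  U *m diag_mx (\row_i (sigma 0 i `^ recip p)) *m V^T.

Definition decrease {R : realType} {m n k : nat}
    (A : 'M[R]_(n, k)) (Y : 'M[R]_(m, k)) (W O : 'M[R]_(m, n)) (eta : R) : R :=
  loss A Y W - loss A Y (W + - (eta *: O)).

Definition Ccoef {R : realType} {m n : nat} (G : 'M[R]_(m, n))
    (U : 'M[R]_(m, minn m n)) (V : 'M[R]_(n, minn m n)) (i : 'I_(minn m n)) : R :=
  (U^T *m G *m V) i i.

Definition Bcoef {R : realType} {m n k : nat} (A : 'M[R]_(n, k))
    (V : 'M[R]_(n, minn m n)) (i : 'I_(minn m n)) : R :=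
  fnorm (A^T *m V *m (delta_mx i 0 : 'cV[R]_(minn m n))) ^+ 2.

Definition numer {R : realType} {m n : nat} (G : 'M[R]_(m, n))
    (U : 'M[R]_(m, minn m n)) (sigma : 'rV[R]_(minn m n))
    (V : 'M[R]_(n, minn m n)) (p : \bar R) : R :=
  \sum_i Ccoef G U V i * sigma 0 i `^ recip p.

Definition denom {R : realType} {m n k : nat} (A : 'M[R]_(n, k))
    (sigma : 'rV[R]_(minn m n)) (V : 'M[R]_(n, minn m n)) (p : \bar R) : R :=
  \sum_i sigma 0 i `^ (2 * recip p) * Bcoef A V i.

(* If the denominator vanishes, the direction does not change the loss, and
   the convention x / 0 = 0 gives the criterion its correct value 0. *)
Definition criterion {R : realType} {m n k : nat}
    (A : 'M[R]_(n, k)) (G : 'M[R]_(m, n)) (U : 'M[R]_(m, minn m n))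
    (sigma : 'rV[R]_(minn m n)) (V : 'M[R]_(n, minn m n)) (p : \bar R) : R :=
  numer G U sigma V p ^+ 2 / denom A sigma V p.

Definition quad_step {R : realType} {m n k : nat}
    (A : 'M[R]_(n, k)) (G : 'M[R]_(m, n)) (U : 'M[R]_(m, minn m n))
    (sigma : 'rV[R]_(minn m n)) (V : 'M[R]_(n, minn m n)) (p : \bar R) : R :=
  k%:R * numer G U sigma V p / denom A sigma V p.

Definition opt_step {R : realType} {m n k : nat}
    (A : 'M[R]_(n, k)) (G : 'M[R]_(m, n)) (U : 'M[R]_(m, minn m n))
    (sigma : 'rV[R]_(minn m n)) (V : 'M[R]_(n, minn m n)) (p : \bar R) : R :=
  if 0 < numer G U sigma V p then quad_step A G U sigma V p else 0.

(* Main.v *)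
(* Along the direction O p the loss is a quadratic in eta with linear
   coefficient -N p and quadratic coefficient D p / (2k): the orthonormal
   columns of U give ||O p A||^2 = D p.  If D p = 0 then O p A = 0, hence N p = 0
   because G factors through A^T.  Completing the square, the largest decrease
   over all step sizes is (k/2) (N p)^2 / D p in every case. *)
Require Import Defs.
From mathcomp Require Import all_boot all_order all_algebra.
From mathcomp Require Import all_classical all_reals all_analysis.
From mathcomp Require Import ring lra.
Import Order.TTheory GRing.Theory Num.Theory.
Import numFieldNormedType.Exports.
Local Open Scope classical_set_scope.
Local Open Scope ring_scope.

Section Frobenius.
Context {R : realType}.

(** As a trace, the form inherits adjointness of left and right multiplication from associativity
    and cyclicity. *)
Lemma frob_trace m n (X Z : 'M[R]_(m, n)) : frob X Z = \tr (X^T *m Z).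
Proof.
rewrite /frob exchange_big; apply: eq_bigr => j _ /=.
by rewrite mxE; apply: eq_bigr => i _; rewrite mxE.
Qed.

Lemma frob_mulmxl m n k (U : 'M[R]_(m, n)) (X : 'M[R]_(n, k)) Z :
  frob (U *m X) Z = frob X (U^T *m Z).
Proof. by rewrite !frob_trace trmx_mul mulmxA. Qed.

Lemma frob_mulmxr m n k (X : 'M[R]_(m, n)) (V : 'M[R]_(n, k)) Z :
  frob (X *m V) Z = frob X (Z *m V^T).
Proof. by rewrite !frob_trace trmx_mul -mulmxA mxtrace_mulC mulmxA. Qed.

Lemma frobC m n (X Z : 'M[R]_(m, n)) : frob X Z = frob Z X.
Proof. by rewrite /frob; under eq_bigr do under eq_bigr do rewrite mulrC. Qed.

Lemma frobDl m n (X X' Z : 'M[R]_(m, n)) :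
  frob (X + X') Z = frob X Z + frob X' Z.
Proof. by rewrite !frob_trace raddfD mulmxDl raddfD. Qed.

Lemma frobZl m n a (X Z : 'M[R]_(m, n)) : frob (a *: X) Z = a * frob X Z.
Proof. by rewrite !frob_trace linearZ -scalemxAl linearZ. Qed.

Lemma frobDr m n (X Z Z' : 'M[R]_(m, n)) :
  frob X (Z + Z') = frob X Z + frob X Z'.
Proof. by rewrite !(frobC m n X) frobDl. Qed.

Lemma frobZr m n a (X Z : 'M[R]_(m, n)) : frob X (a *: Z) = a * frob X Z.
Proof. by rewrite !(frobC m n X) frobZl. Qed.

Lemma frob_ge0 m n (X : 'M[R]_(m, n)) : 0 <= frob X X.
Proof. by do 2! apply: sumr_ge0 => ? _; rewrite -expr2 sqr_ge0. Qed.

Lemma fnorm_sqr m n (X : 'M[R]_(m, n)) : fnorm X ^+ 2 = frob X X.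
Proof. by rewrite sqr_sqrtr ?frob_ge0. Qed.

Lemma frob_eq0 m n (X : 'M[R]_(m, n)) : frob X X = 0 -> X = 0.
Proof.
move=> /psumr_eq0P X0; apply/matrixP => i j; rewrite mxE.
have /psumr_eq0P Xi0 := X0 (fun i _ => sumr_ge0 _ (fun j _ => sqr_ge0 (X i j))) i isT.
by apply/eqP; rewrite -sqrf_eq0 expr2 Xi0 // => j' _; rewrite -expr2 sqr_ge0.
Qed.

(** Pointwise counterpart of [differentiable_sum], which speaks of a sum taken in the space of
    functions. *)
Lemma differentiable_sum_fun {V : normedModType R} n (f : 'I_n -> V -> R) x :
  (forall i, differentiable (f i) x) ->
  differentiable (fun y => \sum_(i < n) f i y) x.
Proof.
move=> df; rewrite (_ : (fun _ => _) = \sum_(i < n) f i).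
  exact: differentiable_sum.
by apply/funext => y; rewrite fct_sumE.
Qed.

End Frobenius.

Section Loss.
Context {R : realType} {m n k : nat}.
Variables (A : 'M[R]_(n, k)) (Y : 'M[R]_(m, k)) (W : 'M[R]_(m, n)).

(** Exact Taylor expansion: the adjoint of right multiplication by A turns the cross term of the
    square into a pairing with [lossgrad]. It yields both the gradient and the quadratic in eta. *)
Lemma loss_shift (hk : (0 < k)%N) H :
  loss A Y (W + H) = loss A Y W + frob (lossgrad A Y W) H
                     + (2 * k%:R)^-1 * frob (H *m A) (H *m A).
Proof.
have k0 : (k%:R : R) != 0 by rewrite pnatr_eq0 -lt0n.
rewrite /loss /lossgrad !fnorm_sqr frobZl frob_mulmxr trmxK.
rewrite mulmxDl addrAC; move: (W *m A - Y) => D.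
rewrite !(frobDl, frobDr) (frobC _ _ (H *m A)).
by field.
Qed.

Lemma loss_differentiable : differentiable (loss A Y) W.
Proof.
rewrite (_ : loss A Y = fun W => (2 * k%:R)^-1 *
    (\sum_i \sum_j (\sum_l W i l * A l j - Y i j) ^+ 2)); last first.
  apply/funext => X; rewrite /loss fnorm_sqr; congr (_ * _).
  by do 2! apply: eq_bigr => ? _; rewrite !mxE expr2.
apply: differentiableM => //.
apply: differentiable_sum_fun => i; apply: differentiable_sum_fun => j.
(* [differentiableX] concerns the exponent n.+1, so 1 stands for the square. *)
apply: (@differentiableX _ _ _ 1); apply: differentiableB => //.
apply: differentiable_sum_fun => l; apply: differentiableM => //.
exact: differentiable_coord.
Qed.

Lemma loss_gradient (hk : (0 < k)%N) :
  is_gradient (loss A Y) W (lossgrad A Y W).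
Proof.
split; first exact: loss_differentiable.
move=> H; rewrite -deriveE; last exact: loss_differentiable.
set c := frob _ _; set b := (2 * k%:R)^-1 * frob (H *m A) (H *m A).
apply: cvg_lim => //.
(* By [loss_shift], the difference quotient at h != 0 is exactly c + h b. *)
have lim_lin : (fun h : R => c + h * b) @ 0^' --> c.
  rewrite -[X in _ --> X]addr0 -[X in _ --> _ + X](mul0r b).
  apply: cvgD; first exact: cvg_cst.
  apply: cvgM; last exact: cvg_cst.
  exact: cvg_within.
apply: cvg_trans lim_lin; apply: near_eq_cvg; near=> h.
have h0 : h != 0 by near: h; exact: nbhs_dnbhs_neq.
rewrite /= [h *: H + W]addrC loss_shift // frobZr -scalemxAl frobZl frobZr.
rewrite -/c /b /GRing.scale/=.
field.
by rewrite h0 andbT pnatr_eq0 -lt0n.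
Unshelve. all: by end_near.
Qed.

End Loss.

Section Direction.
Context {R : realType} {m n : nat}.
Variables (U : 'M[R]_(m, minn m n)) (sigma : 'rV[R]_(minn m n)).
Variables (V : 'M[R]_(n, minn m n)).

(** Once U and V are moved to the side of G, the diagonal factor sees only the diagonal of U^T G
    V. *)
Lemma frob_direction (G : 'M[R]_(m, n)) p :
  frob G (direction U sigma V p) = numer G U sigma V p.
Proof.
rewrite frobC /direction frob_mulmxr trmxK frob_mulmxl mulmxA.
rewrite frobC frob_trace.
rewrite mul_mx_diag; apply: eq_bigr => i _.
by rewrite 2!mxE [X in _ * X]mxE.
Qed.

(** U cancels by orthonormality. What remains is V^T A with row i scaled by sigma_i^(1/p), and that
    row is the transpose of A^T V e_i. *)
Lemma fnorm_direction k (A : 'M[R]_(n, k)) p :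
  U^T *m U = 1%:M ->
  fnorm (direction U sigma V p *m A) ^+ 2 = denom A sigma V p.
Proof.
move=> UU; rewrite /denom /Bcoef fnorm_sqr /direction -!mulmxA frob_mulmxl [U^T *m _]mulmxA UU.
have -> : A^T *m V = (V^T *m A)^T by rewrite trmx_mul trmxK.
rewrite mul1mx mul_diag_mx; move: (V^T *m A) => X.
apply: eq_bigr => i _.
rewrite fnorm_sqr -colE (mulrC 2) powRrM (powR_mulrn 2) ?powR_ge0 //.
rewrite /frob mulr_sumr; apply: eq_bigr => j _; rewrite big_ord1 !mxE.
by ring.
Qed.

End Direction.

Section Quadratic.
Context {R : realType}.
Variables (k N D : R).
Hypotheses (k0 : 0 < k) (D0 : 0 <= D) (DN : D = 0 -> N = 0).

Lemma quad_at_vertex :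
  k * N / D * N - (k * N / D) ^+ 2 / (2 * k) * D = k / 2 * (N ^+ 2 / D).
Proof.
(* If D = 0 then N = 0, and both sides vanish. *)
have [DE|Dn0] := eqVneq D 0; first by rewrite (DN DE); ring.
by field; rewrite Dn0 gt_eqF.
Qed.

Lemma quad_square eta : D != 0 ->
  k / 2 * (N ^+ 2 / D) - (eta * N - eta ^+ 2 / (2 * k) * D) =
  D / (2 * k) * (eta - k * N / D) ^+ 2.
Proof. by move=> Dn0; field; rewrite Dn0 gt_eqF. Qed.

Lemma quad_le_vertex eta :
  eta * N - eta ^+ 2 / (2 * k) * D <= k / 2 * (N ^+ 2 / D).
Proof.
have [DE|Dn0] := eqVneq D 0; first by rewrite DE (DN DE); lra.
rewrite -subr_ge0 quad_square //.
by rewrite mulr_ge0 ?sqr_ge0 // divr_ge0 // mulr_ge0 // ltW.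
Qed.

(** Both terms have the unfavourable sign, so eta = 0 is optimal in the second branch of
    [opt_step]. *)
Lemma quad_le0 eta : 0 <= eta -> N <= 0 -> eta * N - eta ^+ 2 / (2 * k) * D <= 0.
Proof.
move=> eta0 N0; rewrite subr_le0 (le_trans (y := 0)) ?mulr_ge0_le0 //.
by rewrite mulr_ge0 // divr_ge0 ?sqr_ge0 // mulr_ge0 // ltW.
Qed.
End Quadratic.

(** Used with c = k/2 to pass from the best decrease to the criterion. *)
Lemma argmax_pscale {R : realType} {T : Type} (S : set T) (f g : T -> R) c :
  0 < c -> (forall x, S x -> f x = c * g x) -> argmax S f = argmax S g.
Proof.
move=> c0 fE; apply/seteqP; split=> x [Sx max_x].
  split; first exact: Sx.
  move=> y Sy.
  by have := max_x y Sy; rewrite !fE // ler_pM2l.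
split; first exact: Sx.
by move=> y Sy; rewrite !fE // ler_pM2l //; exact: max_x.
Qed.

Theorem proposition2 (R : realType) (m n k : nat) (hk : (0 < k)%N)
    (W : 'M[R]_(m, n)) (A : 'M[R]_(n, k)) (Y : 'M[R]_(m, k))
    (G : 'M[R]_(m, n)) (hG : G = lossgrad A Y W)
    (beta : R) (Mprev M : 'M[R]_(m, n))
    (hM : M = beta *: Mprev + (1 - beta) *: G)
    (U : 'M[R]_(m, minn m n)) (sigma : 'rV[R]_(minn m n))
    (V : 'M[R]_(n, minn m n)) (hsvd : is_thin_svd M U sigma V) :
  let O := direction U sigma V in
  let N := numer G U sigma V in
  let crit := criterion A G U sigma V in
  let eta_quad := quad_step A G U sigma V in
  let eta_opt := opt_step A G U sigma V in
  let best_decrease := fun (step : \bar R -> R) (p : \bar R) =>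
    decrease A Y W (O p) (step p) in
  [/\ (* G is the gradient of the loss at W *)
      is_gradient (loss A Y) W G,
      (* the loss along the update is the displayed quadratic *)
      forall (p : \bar R) (eta : R), exponents p ->
        loss A Y (W + - (eta *: O p)) - loss A Y W =
        - eta * frob G (O p)
        + eta ^+ 2 / (2 * k%:R) * fnorm (O p *m A) ^+ 2,
      (* step sizes ranging over all of R *)
      (forall p, exponents p ->
         argmax [set: R] (decrease A Y W (O p)) (eta_quad p)) /\
      (forall step : \bar R -> R,
         (forall p, exponents p ->
            argmax [set: R] (decrease A Y W (O p)) (step p)) ->
         argmax exponents (best_decrease step) = argmax exponents crit)
    & (* nonnegative step sizes: k N / D if N > 0, and 0 otherwise *)
      [/\ forall p, exponents p ->
            argmax [set eta : R | 0 <= eta] (decrease A Y W (O p)) (eta_opt p),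
          (forall q, exponents q -> 0 <= N q) ->
            argmax exponents (best_decrease eta_opt) = argmax exponents crit
        & forall pstar, argmax exponents crit pstar -> 0 <= N pstar ->
            argmax exponents (best_decrease eta_opt) pstar /\
            argmax exponents (best_decrease eta_opt) `<=`
              argmax exponents crit]].
Proof.
case: hsvd => UU _ _ _ /=; subst G; set G := lossgrad A Y W.
have kR0 : 0 < k%:R :> R by rewrite ltr0n.
have dec p eta : decrease A Y W (direction U sigma V p) eta =
    eta * numer G U sigma V p - eta ^+ 2 / (2 * k%:R) * denom A sigma V p.
  rewrite /decrease loss_shift // -scaleNr frobZr -scalemxAl frobZl frobZr.
  rewrite -(fnorm_direction _ _ _ _ _ _ UU) fnorm_sqr -(frob_direction U sigma V).
  by ring.
have D0 p : 0 <= denom A sigma V p.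
  by rewrite -(fnorm_direction _ _ _ _ _ _ UU) sqr_ge0.
have DN p : denom A sigma V p = 0 -> numer G U sigma V p = 0.
  rewrite -(fnorm_direction _ _ _ _ _ _ UU) fnorm_sqr => /frob_eq0 OA0.
  (* Moving A^T across the product gives N = <WA - Y, O A> / k. *)
  rewrite -(frob_direction U sigma V) frobZl frob_mulmxr trmxK OA0.
  by rewrite frobC -[0](scale0r 0) frobZl mul0r mulr0.
have dec_quad p : decrease A Y W (direction U sigma V p)
    (quad_step A G U sigma V p) = k%:R / 2 * criterion A G U sigma V p.
  rewrite dec quad_at_vertex //; exact: DN.
have dec_le p eta : decrease A Y W (direction U sigma V p) eta <=
    k%:R / 2 * criterion A G U sigma V p.
  rewrite dec quad_le_vertex //; exact: DN.
have k20 : 0 < k%:R / 2 :> R by rewrite divr_gt0.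
have dec_opt p : 0 <= numer G U sigma V p ->
    decrease A Y W (direction U sigma V p) (opt_step A G U sigma V p) =
    k%:R / 2 * criterion A G U sigma V p.
  rewrite /opt_step le_eqVlt => /predU1P[N0|->]; last exact: dec_quad.
  rewrite -N0 ltxx dec /criterion -N0; ring.
split.
- exact: loss_gradient.
- move=> p eta _; rewrite fnorm_sqr loss_shift // -scaleNr frobZr -scalemxAl.
  by rewrite frobZl frobZr; ring.
- split=> [p _|step max_step].
    by split=> // eta _; rewrite dec_quad.
  (* Optimal steps are not unique when D = 0, so values are compared: [dec_le] bounds the decrease
     above, and maximality against [quad_step] bounds it below. *)
  apply: (argmax_pscale _ _ _ _ k20) => p Ep; apply/le_anti; rewrite dec_le /= -dec_quad.
  by have [_ ->] := max_step p Ep.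
(* An exponent with N < 0 has a positive criterion but best decrease 0 over nonnegative steps; hence
   the sign conditions on N. *)
- split=> [p _|N0|pstar [Estar max_star] N0].
  + have [N0|N0] := ltP 0 (numer G U sigma V p).
      have N0' := ltW N0; split=> [|eta _]; last by rewrite dec_opt.
      by rewrite /opt_step N0 /= divr_ge0 // mulr_ge0.
    rewrite /opt_step ltNge N0; split=> //= eta eta0.
    rewrite [leRHS]dec mul0r expr0n !mul0r subrr dec; exact: quad_le0.
  + by apply: (argmax_pscale _ _ _ _ k20) => p Ep; rewrite dec_opt // N0.
  + split.
      split; first exact: Estar.
      move=> q Eq; rewrite (dec_opt _ N0); apply: le_trans (dec_le _ _) _.
      by rewrite (ler_pM2l k20); exact: max_star.
    (* The sign of N at p is unknown, so only the bound [dec_le] is used there: up to the factor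
       k/2, crit q <= crit pstar = best pstar <= best p <= crit p. *)
    move=> p [Ep max_p]; split; first exact: Ep.
    move=> q Eq; apply: le_trans (max_star q Eq) _.
    rewrite -(ler_pM2l k20) -(dec_opt _ N0).
    exact: le_trans (max_p _ Estar) (dec_le _ _).
Qed.
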